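(* Let $\Gamma$ be a finite connected graph and let $1\neq g\in A(\Gamma)$ be cyclically reduced. Then $g$ is elliptic (with respect to the action of $A(\Gamma)$ on the extension graph $\Gamma^e$) if and only if the support of $g$ is contained in a join of $\Gamma$.
   Context: Graphs are simplicial. $A(\Gamma)=\langle V(\Gamma)\mid [a,b]=1 \text{ for each } \{a,b\}\in E(\Gamma)\rangle$ is the right-angled Artin group on $\Gamma$. The extension graph $\Gamma^e$ has vertex set $\{v^g : v\in V(\Gamma), g\in A(\Gamma)\}$, where $v^g=g^{-1}vg$, with two distinct vertices adjacent if and only if they commute in $A(\Gamma)$; it carries the graph metric $d$, and $A(\Gamma)$ acts on it by conjugation, $g$ sending $v^h$ to $v^{hg}$. An element $g\ne1$ is elliptic if one (equivalently every) orbit of $\langle g\rangle$ in $\Gamma^e$ is bounded; it is loxodromic if $\lim_{n\to\infty}\frac1n d(x,x^{g^n})>0$ for $x\in\Gamma^e$. The support of $g$ is the set of vertices $v$ such that $v$ or $v^{-1}$ occurs in a shortest word in $V(\Gamma)\cup V(\Gamma)^{-1}$ representing $g$. An element is cyclically reduced if its word length is minimal in its conjugacy class. A graph is a join if its vertex set is a disjoint union of two nonempty subsets such that every vertex of one is adjacent to every vertex of the other. ''The support of $g$ is contained in a join of $\Gamma$'' means that it is contained in the vertex set of a subgraph of $\Gamma$ which is a join.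
   Formalization: The graph is assumed to have at least two vertices: for a single vertex the extension graph is a point, so every nontrivial element is elliptic, while its support lies in no join; for the empty graph the claim is vacuous. *)

(* Defs.v *)
From HB Require Import structures.
From mathcomp Require Import all_boot.
From mathcomp Require Import boolp.

Set Implicit Arguments.
Unset Strict Implicit.
Unset Printing Implicit Defensive.

Local Open Scope quotient_scope.
Local Open Scope group_scope.

Record sgraph := SGraph {
  vertex :> finType;
  adj : rel vertex;
  adj_sym : symmetric adj;
  adj_irrefl : irreflexive adj }.
Arguments adj {s}.

Definition connected_graph (G : sgraph) := forall x y : G, connect adj x y.

Record subgraph (G : sgraph) := Subgraph {
  sub_vertices : {set G};
  sub_adj : rel G;
  sub_adj_sym : symmetric sub_adj;
  sub_adjP : forall x y, sub_adj x y ->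
    [/\ x \in sub_vertices, y \in sub_vertices & adj x y] }.

Definition is_join (G : sgraph) (H : subgraph G) := exists A B : {set G},
  [/\ A :|: B = sub_vertices H, [disjoint A & B], A != set0, B != set0
    & {in A & B, forall a b, sub_adj H a b}].

Section Raag.
Variable G : sgraph.

(** [(v, true)] stands for the letter [v] and [(v, false)] for [v^-1]. *)
Definition letter := (G * bool)%type.
Definition word := seq letter.

Definition inv_letter (a : letter) : letter := (a.1, ~~ a.2).
Definition inv_word (w : word) : word := rev (map inv_letter w).

(** The least congruence on words containing the free cancellations and the
    relations [ab = ba] for adjacent [a] and [b]; its quotient is the presented
    group. *)
Inductive raag_cong : word -> word -> Prop :=
| RC_refl w : raag_cong w w
| RC_sym w1 w2 : raag_cong w1 w2 -> raag_cong w2 w1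
| RC_trans w1 w2 w3 :
    raag_cong w1 w2 -> raag_cong w2 w3 -> raag_cong w1 w3
| RC_cat w1 w2 w1' w2' :
    raag_cong w1 w1' -> raag_cong w2 w2' -> raag_cong (w1 ++ w2) (w1' ++ w2')
| RC_cancel a : raag_cong [:: a; inv_letter a] [::]
| RC_comm (a b : G) : adj a b ->
    raag_cong [:: (a, true); (b, true)] [:: (b, true); (a, true)].

Definition raag_congb (w1 w2 : word) : bool := `[< raag_cong w1 w2 >].

Lemma raag_congb_refl : reflexive raag_congb.
Proof. by move=> w; apply/asboolP; exact: RC_refl. Qed.

Lemma raag_congb_sym : symmetric raag_congb.
Proof. by move=> w1 w2; apply/asboolP/asboolP; exact: RC_sym. Qed.

Lemma raag_congb_trans : transitive raag_congb.
Proof.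
by move=> w2 w1 w3 /asboolP h1 /asboolP h2; apply/asboolP; exact: RC_trans h2.
Qed.

Canonical raag_equiv :=
  EquivRel raag_congb raag_congb_refl raag_congb_sym raag_congb_trans.

Definition raag := {eq_quot raag_equiv}.
HB.instance Definition _ := Choice.on raag.
HB.instance Definition _ := EqQuotient.on raag.

Definition raag_of (w : word) : raag := \pi_raag w.

Lemma raag_ofP w1 w2 : raag_of w1 = raag_of w2 <-> raag_cong w1 w2.
Proof.
split=> [/eqP|h]; last by apply/eqP; rewrite /raag_of piE; apply/asboolP.
by rewrite /raag_of piE => /asboolP.
Qed.

Lemma raag_of_repr (x : raag) : raag_of (repr x) = x.
Proof. exact: reprK. Qed.

Lemma inv_wordK : involutive inv_word.
Proof.
move=> w; rewrite /inv_word map_rev revK -map_comp map_id_in //.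
by move=> [v b] _; rewrite /= /inv_letter /= negbK.
Qed.

Lemma inv_word_cat w1 w2 : inv_word (w1 ++ w2) = inv_word w2 ++ inv_word w1.
Proof. by rewrite /inv_word map_cat rev_cat. Qed.

Lemma raag_cong_inv_l w : raag_cong (inv_word w ++ w) [::].
Proof.
elim: w => [|a w IHw]; first exact: RC_refl.
rewrite -cat1s inv_word_cat -catA.
apply: RC_trans IHw; apply: RC_cat; first exact: RC_refl.
rewrite catA -[X in raag_cong _ X]cat0s; apply: RC_cat; last exact: RC_refl.
have := RC_cancel (inv_letter a).
by case: a => v b; rewrite /inv_letter /= negbK.
Qed.

Lemma raag_cong_inv_r w : raag_cong (w ++ inv_word w) [::].
Proof. by have := raag_cong_inv_l (inv_word w); rewrite inv_wordK. Qed.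

Lemma raag_cong_inv w1 w2 :
  raag_cong w1 w2 -> raag_cong (inv_word w1) (inv_word w2).
Proof.
move=> h; apply: (@RC_trans _ (inv_word w1 ++ (w2 ++ inv_word w2))).
  rewrite -[X in raag_cong X _]cats0; apply: RC_cat; first exact: RC_refl.
  exact/RC_sym/raag_cong_inv_r.
rewrite catA -[X in raag_cong _ X]cat0s; apply: RC_cat; last exact: RC_refl.
apply: RC_trans (raag_cong_inv_l w1).
by apply: RC_cat; [exact: RC_refl | exact: RC_sym].
Qed.

Definition raag_one : raag := raag_of [::].
Definition raag_mul (x y : raag) : raag := raag_of (repr x ++ repr y).
Definition raag_inv (x : raag) : raag := raag_of (inv_word (repr x)).

Lemma raag_of_cat w1 w2 : raag_mul (raag_of w1) (raag_of w2) = raag_of (w1 ++ w2).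
Proof. by apply/raag_ofP; apply: RC_cat; apply/raag_ofP/raag_of_repr. Qed.

Lemma raag_of_inv w : raag_inv (raag_of w) = raag_of (inv_word w).
Proof. by apply/raag_ofP/raag_cong_inv/raag_ofP/raag_of_repr. Qed.

Lemma raag_mulA : associative raag_mul.
Proof.
move=> x y z; rewrite -[x]raag_of_repr -[y]raag_of_repr -[z]raag_of_repr.
by rewrite !raag_of_cat catA.
Qed.

Lemma raag_mul1 : left_id raag_one raag_mul.
Proof. by move=> x; rewrite -[x]raag_of_repr raag_of_cat. Qed.

Lemma raag_mulr1 : right_id raag_one raag_mul.
Proof. by move=> x; rewrite -[x]raag_of_repr raag_of_cat cats0. Qed.

Lemma raag_mulV : left_inverse raag_one raag_inv raag_mul.
Proof.
move=> x; rewrite -[x]raag_of_repr raag_of_inv raag_of_cat.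
exact/raag_ofP/raag_cong_inv_l.
Qed.

Lemma raag_mulrV : right_inverse raag_one raag_inv raag_mul.
Proof.
move=> x; rewrite -[x]raag_of_repr raag_of_inv raag_of_cat.
exact/raag_ofP/raag_cong_inv_r.
Qed.

HB.instance Definition _ := isGroup.Build raag
  raag_mulA raag_mul1 raag_mulr1 raag_mulV raag_mulrV.

Definition raag_gen (v : G) : raag := raag_of [:: (v, true)].

Lemma raag_length_ex (g : raag) :
  exists n, `[< exists2 w : word, raag_of w = g & size w = n >].
Proof.
by exists (size (repr g)); apply/asboolP; exists (repr g); rewrite ?raag_of_repr.
Qed.

Definition raag_length (g : raag) : nat := ex_minn (raag_length_ex g).

Definition cyclically_reduced (g : raag) :=
  forall h : raag, raag_length g <= raag_length (g ^ h).

Definition shortest_word (g : raag) (w : word) :=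
  raag_of w = g /\ size w = raag_length g.

Definition raag_support (g : raag) : {set G} :=
  [set v | `[< exists2 w, shortest_word g w
                        & (v, true) \in w \/ (v, false) \in w >]].

End Raag.
Arguments raag_gen {G}.

Definition in_join (G : sgraph) (S : {set G}) :=
  exists2 H : subgraph G, is_join H & S \subset sub_vertices H.

Section GraphMetric.
Variables (T : eqType) (e : rel T).

Definition has_walk (x y : T) (n : nat) :=
  exists p : seq T, [/\ path e x p, last x p = y & size p = n].

(** [None] is the infinite distance. *)
Definition gdist (x y : T) : option nat :=
  match pselect (exists n, `[< has_walk x y n >]) with
  | left h => Some (ex_minn h)
  | right _ => None
  end.

Definition gbounded (S : T -> Prop) := exists M : nat,
  forall x y, S x -> S y -> exists2 n, gdist x y = Some n & n <= M.

End GraphMetric.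

Section Extension.
Variable G : sgraph.

(** The library's [x ^ y] is [y^-1 * (x * y)]. *)
Definition is_ext_vertex (x : raag G) : bool :=
  `[< exists v g, x = raag_gen v ^ g >].

Definition ext_vertex : Type := {x : raag G | is_ext_vertex x}.
HB.instance Definition _ := Choice.on ext_vertex.
HB.instance Definition _ := SubType.on ext_vertex.

Definition ext_adj : rel ext_vertex := fun x y =>
  (x != y) && (val x * val y == val y * val x).

Lemma ext_act_subproof (x : ext_vertex) (g : raag G) : is_ext_vertex (val x ^ g).
Proof.
case: x => x /= /asboolP[v [h ->]]; apply/asboolP; exists v, (h * g).
by rewrite conjgM.
Qed.

Definition ext_act (x : ext_vertex) (g : raag G) : ext_vertex :=
  Sub (val x ^ g) (ext_act_subproof x g).

Definition cyclic_orbit (g : raag G) (x : ext_vertex) : ext_vertex -> Prop :=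
  fun y => exists n : nat, y = ext_act x (g ^+ n) \/ y = ext_act x (g ^- n).

Definition elliptic (g : raag G) :=
  g <> 1 /\ exists x : ext_vertex, gbounded ext_adj (cyclic_orbit g x).

End Extension.

(* Main.v *)
Require Import Defs.
From mathcomp Require Import all_boot.
From mathcomp Require Import boolp.

(** The geometry behind the theorem is that of the walls of the Cayley graph
    of A(G).  Declare two edges parallel when they are opposite in a square
    spanned by two commuting generators; the edges parallel to the edge from
    1 to v are those from y to yv with y in the subgroup <Lk v> generated by
    the link of v, and removing them cuts the Cayley graph into two
    half-spaces.  To see this without normal forms, count modulo 2 how often a
    word crosses this wall: the parity is invariant under the defining
    relations, so it is a function of the group element ([wall_side]).  Write
    W_c for the half-space beyond the edge from 1 to the letter c
    ([halfspace]).  The whole combinatorics of reduced words follows from four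
    facts: W_c is stable under left multiplication by <Lk c> and under right
    multiplication by generators other than that of c; W_c and W_d are disjoint
    if c and d are distinct letters whose vertices are equal or not adjacent
    ([halfspace_disjoint]); and c maps the complement of W_(c^-1) onto W_c.
    In particular a reduced word c f lies in W_c ([reduced_halfspace]), and the
    half-spaces met along a reduced word at two non-adjacent letters are nested
    ([halfspace_nested]).

    If the support lies in a join A * B, then for a in A and b in B every
    conjugate of a by a power of g is a conjugate of a by an element of <A>,
    hence commutes with b: the orbit of a lies in the unit ball around b.

    Conversely, if v^x and u^y commute then x y^-1 is a product of an element
    of <St v> and one of <St u> ([commuting_conj]).  Hence an edge path of
    length n in the extension graph from v^x to u^y gives a path from x^-1 to
    y^-1 in A(G) made of 2n + 2 steps, each of which multiplies on the right by
    an element of the subgroup of some star ([ext_adj_star_path]).  If the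
    orbit of a vertex under g is bounded, all powers g^N are then joined to 1 by
    a bounded number of such star steps.

    Suppose that the support S is not contained in a join.  Then the complement
    graph of S is connected, as otherwise S itself spans a join, and no star
    contains S, as each star is a join (a vertex has a neighbour because the
    graph is connected and has two vertices).  Take a shortest word w for g; since g
    is cyclically reduced, w w is reduced.  For a in S let K_a be the
    half-space met along w at the first occurrence of a, so that 1 is not in
    K_a and g is.  The nesting lemma gives g K_b inside K_a for a, b not
    adjacent, and connectedness gives g^D K_b inside K_a for all a, b in S, with
    D the number of vertices.  A star step omits some u in S and therefore does
    not change membership in any translate of K_u, so it cannot advance through
    more than 2D of the nested translates of K_a.  As g^N lies in g^(N-1) K_a,
    at least N / 2D star steps separate it from 1, which contradicts
    boundedness. *)

Set Implicit Arguments.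
Unset Strict Implicit.
Unset Printing Implicit Defensive.

Local Open Scope group_scope.

(** * Words, letters and subgroups spanned by vertices *)

Section Words.
Variable G : sgraph.
Implicit Types (P Q : pred G) (x y z : raag G) (w : word G) (c d : letter G).

Definition letter_val c : raag G := raag_of [:: c].

Lemma raag_of_nil : raag_of [::] = 1 :> raag G.
Proof. by []. Qed.

Lemma raag_of_catM w1 w2 : raag_of (w1 ++ w2) = raag_of w1 * raag_of w2.
Proof. by rewrite -raag_of_cat. Qed.

Lemma raag_of_cons c w : raag_of (c :: w) = letter_val c * raag_of w.
Proof. by rewrite -cat1s raag_of_catM. Qed.

Lemma raag_of_rcons w c : raag_of (rcons w c) = raag_of w * letter_val c.
Proof. by rewrite -cats1 raag_of_catM. Qed.

Lemma raag_of_invM w : raag_of (inv_word w) = (raag_of w)^-1.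
Proof. by rewrite -raag_of_inv. Qed.

Lemma inv_letter_neq c : inv_letter c != c.
Proof. by case: c => v []; rewrite /inv_letter xpair_eqE eqxx. Qed.

Lemma letter_val_inv c : letter_val (inv_letter c) = (letter_val c)^-1.
Proof. by rewrite -raag_of_invM. Qed.

Lemma letter_valK c : letter_val c * letter_val (inv_letter c) = 1.
Proof. by rewrite letter_val_inv mulgV. Qed.

Lemma letter_val_pos v : letter_val (v, true) = raag_gen v.
Proof. by []. Qed.

Lemma commute_letter c d : adj c.1 d.1 -> commute (letter_val c) (letter_val d).
Proof.
have pos u v : adj u v -> commute (letter_val (u, true)) (letter_val (v, true)).
  by move=> uv; rewrite /commute -!raag_of_catM; apply/raag_ofP/RC_comm.
have neg v : letter_val (v, false) = (letter_val (v, true))^-1.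
  by rewrite -letter_val_inv.
case: c d => [u [] ] [v []] /= /pos uv //; rewrite ?neg; first exact: commuteV.
  exact/commute_sym/commuteV/commute_sym.
exact/commuteV/commute_sym/commuteV/commute_sym.
Qed.

Definition spanned P x := exists2 w, all (P \o fst) w & raag_of w = x.

Lemma spanned1 P : spanned P 1.
Proof. by exists [::]. Qed.

Lemma spanned_letter P c : P c.1 -> spanned P (letter_val c).
Proof. by move=> Pc; exists [:: c]; rewrite //= Pc. Qed.

Lemma spannedM P x y : spanned P x -> spanned P y -> spanned P (x * y).
Proof.
case=> w1 P1 <- [w2 P2 <-]; exists (w1 ++ w2); last by rewrite raag_of_catM.
by rewrite all_cat P1.
Qed.

Lemma spannedV P x : spanned P x -> spanned P x^-1.
Proof.
case=> w Pw <-; exists (inv_word w); last by rewrite raag_of_invM.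
by rewrite /inv_word all_rev all_map; apply: sub_all Pw => -[].
Qed.

Lemma spannedMl P x y : spanned P x -> spanned P (x * y) <-> spanned P y.
Proof.
move=> Px; split=> [Pxy|]; last exact: spannedM.
by rewrite -(mulKg x y); apply: spannedM Pxy; exact: spannedV.
Qed.

Lemma spannedMr P x y : spanned P y -> spanned P (x * y) <-> spanned P x.
Proof.
move=> Py; split=> [Pxy|Px]; last exact: spannedM.
by rewrite -(mulgK y x); apply: spannedM Pxy _; exact: spannedV.
Qed.

Lemma spannedX P x n : spanned P x -> spanned P (x ^+ n).
Proof.
move=> Px; elim: n => [|n IHn]; first exact: spanned1.
by rewrite expgS; apply: spannedM.
Qed.

Lemma sub_spanned P Q x : subpred P Q -> spanned P x -> spanned Q x.
Proof. by move=> PQ [w Pw <-]; exists w => //; apply: sub_all Pw => c /PQ. Qed.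

Lemma commute_spanned P c x :
  (forall v, P v -> adj c.1 v) -> spanned P x -> commute (letter_val c) x.
Proof.
move=> Pc [w Pw <-]; elim: w Pw => [_|d w IHw /= /andP[/Pc cd /IHw cw]].
  exact: commute1.
by rewrite raag_of_cons; apply: commuteM => //; apply: commute_letter.
Qed.

Lemma raag_ind (K : raag G -> Prop) :
  K 1 -> (forall x c, K x -> K (x * letter_val c)) -> forall x, K x.
Proof.
move=> K1 KM x; rewrite -[x]raag_of_repr.
by elim/last_ind: (repr x) => // w c Kw; rewrite raag_of_rcons; apply: KM.
Qed.

End Words.

(** * Walls and half-spaces *)

Section Halfspaces.
Variable G : sgraph.
Implicit Types (P Q : pred G) (x y z : raag G) (w : word G) (c d : letter G).
Implicit Types (u v : G).

(** The edge from [x] to [x * c] is parallel to the edge from 1 to [v] exactly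
    when its initial vertex for the positive orientation lies in <Lk v>. *)
Definition crosses v x c : bool :=
  (c.1 == v) && `[< spanned (adj v) (if c.2 then x else x * letter_val c) >].

Fixpoint crossing_parity v x w : bool :=
  if w is c :: w' then crosses v x c (+) crossing_parity v (x * letter_val c) w'
  else false.

Lemma crossing_parity_cat v x w1 w2 : crossing_parity v x (w1 ++ w2) =
  crossing_parity v x w1 (+) crossing_parity v (x * raag_of w1) w2.
Proof.
elim: w1 x => [|c w1 IHw] x /=; first by rewrite raag_of_nil mulg1.
by rewrite IHw raag_of_cons mulgA addbA.
Qed.

(** Opposite sides of a commutation square are parallel, so both ways around
    the square cross the same walls. *)
Lemma crossing_parity_cong v w1 w2 : raag_cong w1 w2 ->
  forall x, crossing_parity v x w1 = crossing_parity v x w2.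
Proof.
elim=> {w1 w2} // [w1 w2 w3 _ e12 _ e23 x|w1 w2 w1' w2' h1 e1 _ e2 x|c x|a b ab x].
- by rewrite e12.
- by rewrite !crossing_parity_cat e1 e2; move/raag_ofP: h1 => ->.
- rewrite /= addbF /crosses; case: c => u [] /=; case: (u == v) => //=.
    by rewrite -mulgA letter_valK mulg1 addbb.
  by rewrite addbb.
- rewrite /= !addbF /crosses /=.
  case: eqP => [<-|_]; case: eqP => [eab|_] //=; rewrite ?addbF.
  + by rewrite eab adj_irrefl in ab.
  + by apply: asbool_equiv_eq; apply: iff_sym; apply: spannedMr; apply: spanned_letter.
  + apply: asbool_equiv_eq; apply: spannedMr; apply: spanned_letter.
    by rewrite -eab adj_sym.
Qed.

Definition wall_side v x := crossing_parity v 1 (repr x).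

Lemma wall_side1 v : wall_side v 1 = false.
Proof.
rewrite /wall_side -[RHS]/(crossing_parity v 1 [::]).
by apply/crossing_parity_cong/raag_ofP; rewrite raag_of_repr.
Qed.

Lemma wall_sideMr v x c :
  wall_side v (x * letter_val c) = wall_side v x (+) crosses v x c.
Proof.
have -> : crosses v x c = crossing_parity v (1 * raag_of (repr x)) [:: c].
  by rewrite mul1g raag_of_repr /= addbF.
rewrite /wall_side -crossing_parity_cat; apply/crossing_parity_cong/raag_ofP.
by rewrite raag_of_repr raag_of_catM raag_of_repr.
Qed.

Lemma wall_side_other v x c : c.1 != v ->
  wall_side v (x * letter_val c) = wall_side v x.
Proof. by move=> /negPf cv; rewrite wall_sideMr /crosses cv addbF. Qed.

Lemma wall_side_spanned_r v x y : spanned (predC1 v) y ->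
  wall_side v (x * y) = wall_side v x.
Proof.
case=> w + <-; elim: w x => [|c w IHw] x /=; first by rewrite raag_of_nil mulg1.
by case/andP=> /wall_side_other cv /IHw h; rewrite raag_of_cons mulgA h.
Qed.

Lemma adj_neq u v : adj u v -> v != u.
Proof. by apply: contraTneq => ->; rewrite adj_irrefl. Qed.

(** Left multiplication by <Lk v> permutes the edges of the wall of [v] and
    fixes the side of 1. *)
Lemma wall_side_spanned_l v x y : spanned (adj v) y ->
  wall_side v (y * x) = wall_side v x.
Proof.
move=> Ly; elim/raag_ind: x => [|x c IHx].
  rewrite mulg1 -[y]mul1g wall_side_spanned_r //.
  by apply: sub_spanned Ly => u; exact: adj_neq.
rewrite mulgA !wall_sideMr IHx; congr (_ (+) (_ && _)).
by case: c.2; rewrite -?mulgA; apply: asbool_equiv_eq; apply: spannedMl.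
Qed.

Lemma wall_side_gen v : wall_side v (raag_gen v).
Proof.
rewrite -[raag_gen v]mul1g (wall_sideMr v 1 (v, true)) wall_side1 /crosses eqxx /=.
exact/asboolP/spanned1.
Qed.

Lemma gen_not_adj_spanned v : ~ spanned (adj v) (raag_gen v).
Proof.
move=> Lv; have := wall_side_gen v; rewrite -[raag_gen v]mulg1.
by rewrite wall_side_spanned_l // wall_side1.
Qed.

(** For a letter [v^-1] this is the translate by [v^-1] of the complement of
    the half-space of [v]: the edge from 1 to [v^-1] is the translate of the
    edge from 1 to [v], traversed backwards. *)
Definition halfspace c x :=
  if c.2 then wall_side c.1 x else ~~ wall_side c.1 (raag_gen c.1 * x).

Lemma halfspace1 c : ~~ halfspace c 1.
Proof.
by case: c => v [] /=; rewrite /halfspace /= ?wall_side1 // mulg1 wall_side_gen.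
Qed.

Lemma halfspace_letterM c x :
  halfspace c (letter_val c * x) = ~~ halfspace (inv_letter c) x.
Proof.
case: c => v [] /=; rewrite /halfspace /= ?negbK //.
by rewrite mulgA letter_valK mul1g.
Qed.

Lemma halfspace_spanned_r c x y : spanned (predC1 c.1) y ->
  halfspace c (x * y) = halfspace c x.
Proof.
by case: c => v [] Py; rewrite /halfspace /= ?mulgA (wall_side_spanned_r _ Py).
Qed.

Lemma halfspace_spanned_l c x y : spanned (adj c.1) y ->
  halfspace c (y * x) = halfspace c x.
Proof.
case: c => v b /= Ly; have cy : raag_gen v * y = y * raag_gen v.
  exact: (commute_spanned (c := (v, true)) (fun _ => id) Ly).
by case: b; rewrite /halfspace /= ?mulgA ?cy -?mulgA (wall_side_spanned_l _ Ly).
Qed.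

Lemma halfspace_spanned c y : spanned (predC1 c.1) y -> ~~ halfspace c y.
Proof.
by move=> Py; rewrite -[y]mul1g halfspace_spanned_r // halfspace1.
Qed.

Definition star v : pred G := fun u => (u == v) || adj v u.

(** The endpoints of the edges dual to the wall of a letter at [v] lie in the
    subgroup of the star of [v]. *)
Lemma halfspace_flip c x d :
  halfspace c (x * letter_val d) != halfspace c x -> spanned (star c.1) x.
Proof.
have base v y : wall_side v (y * letter_val d) != wall_side v y ->
    spanned (star v) y.
  rewrite wall_sideMr; case cr: (crosses v y d); last by rewrite addbF eqxx.
  move=> _; case/andP: cr => /eqP dv /asboolP Ly.
  have {}Ly : spanned (star v) (if d.2 then y else y * letter_val d).
    by apply: sub_spanned Ly => u; rewrite /star => ->; rewrite orbT.
  case: d.2 Ly => // /spannedMr; apply.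
  by apply: spanned_letter; rewrite /star dv eqxx.
case: c => v [] /=; rewrite /halfspace /=; first exact: base.
rewrite (inj_eq negb_inj) mulgA => /base /spannedMl; apply.
by apply: (@spanned_letter _ _ (v, true)); rewrite /star eqxx.
Qed.

(** Disjointness of the half-spaces of [v] and [v^-1]: translation by [v] maps
    the half-space of [v] into itself.  By induction along a path from 1, it is
    enough to inspect the edges across which one of the two sides changes.
    The edges of the wall of [v] are moved by [v] beyond the wall, as [v] is not
    in <Lk v>; the edges that [v] moves to the wall have both ends on the side
    of 1. *)
Lemma wall_side_mul_gen v x : wall_side v x -> wall_side v (raag_gen v * x).
Proof.
elim/raag_ind: x => [|x d IHx]; first by rewrite wall_side1.
have Lside y : spanned (adj v) y -> wall_side v y = false.
  by move=> Ly; rewrite -[y]mulg1 wall_side_spanned_l // wall_side1.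
have Lcomm y : spanned (adj v) y -> raag_gen v * y = y * raag_gen v.
  by move=> Ly; exact: (commute_spanned (c := (v, true)) (fun _ => id) Ly).
rewrite mulgA !wall_sideMr.
case cr: (crosses v x d).
  case/andP: cr => /eqP; case: d {IHx} => u [] /= -> /asboolP Ly.
    rewrite Lside // Lcomm // wall_side_spanned_l // wall_side_gen /crosses /= eqxx.
    move=> _ /=; apply/negP=> /asboolP; rewrite -/(raag_gen v).
    by move=> /(proj1 (spannedMl _ Ly)); exact: gen_not_adj_spanned.
  have := wall_sideMr v x (v, false); rewrite (Lside _ Ly) /crosses /= eqxx.
  by rewrite (asboolT Ly) => <-.
rewrite addbF; case cr' : (crosses v _ d); last by rewrite addbF.
have /andP[/eqP dv /asboolP Ly] := cr'.
move=> fx; have := IHx fx.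
case: d dv {cr cr' IHx} Ly => u [] /= uv Ly; first by rewrite (Lside _ Ly).
rewrite {}uv in Ly *.
suff xE : raag_gen v * x * letter_val (v, false) = x.
  by rewrite -xE (Lside _ Ly) in fx.
have := Lcomm _ Ly; rewrite -[in RHS]mulgA (letter_valK (v, false)) mulg1.
exact: mulgI.
Qed.

(** For letters at different vertices, a path from 1 that is in one of the
    half-spaces can enter the other one only across an edge of its wall.  The
    ends of such an edge lie in the star subgroup of one letter, which avoids
    the vertex of the other letter, and hence outside the half-space of the
    other letter. *)
Lemma halfspace_disjoint c d x :
  ~~ adj c.1 d.1 -> c != d -> halfspace c x -> ~~ halfspace d x.
Proof.
case: (eqVneq c.1 d.1) => [|cd nadj _].
  case: c d => [v b] [u b'] /= -> _; case: b b' => [] [] /=; rewrite ?eqxx //.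
    by rewrite /halfspace /= negbK => _; exact: wall_side_mul_gen.
  by move=> _; apply: contraNN; exact: wall_side_mul_gen.
apply: contraTN; elim/raag_ind: x => [|x e IHx]; first by rewrite (negPf (halfspace1 _)).
have off c' d' y : c'.1 != d'.1 -> ~~ adj c'.1 d'.1 -> spanned (star c'.1) y ->
    ~~ halfspace d' y.
  move=> neq nad /sub_spanned Py; apply: halfspace_spanned; apply: Py => u /=.
  by rewrite /star => /orP[/eqP->//|]; apply: contraTneq => ->.
case: (eqVneq (halfspace c (x * letter_val e)) (halfspace c x)) => [->|flip].
  case: (eqVneq (halfspace d (x * letter_val e)) (halfspace d x)) => [-> //|flip _].
  by apply: off (halfspace_flip flip); rewrite 1?eq_sym // adj_sym.
have {}flip : spanned (star c.1) (x * letter_val e).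
  apply: (@halfspace_flip _ _ (inv_letter e)).
  by rewrite -mulgA letter_valK mulg1 eq_sym.
by rewrite (negPf (off _ _ _ cd nadj flip)).
Qed.

End Halfspaces.

(** * Reduced words *)

Section Reduced.
Variable G : sgraph.
Implicit Types (x y z : raag G) (w f k u : word G) (a b c d : letter G) (v : G).

Definition linked c d := adj c.1 d.1.

Lemma spanned_linked c w : all (linked c) w -> spanned (adj c.1) (raag_of w).
Proof. by exists w. Qed.

Lemma commute_linked c w :
  all (linked c) w -> commute (letter_val c) (raag_of w).
Proof. by move=> /spanned_linked; apply: commute_spanned. Qed.

(** No later letter cancels [c] after moving past letters that commute with
    it: the first letter of [f] not adjacent to [c] is not its inverse.  The
    default value [c] of [head] makes this true if there is no such letter. *)
Definition survives c f := head c [seq d <- f | ~~ linked c d] != inv_letter c.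

Fixpoint reduced w := if w is c :: f then survives c f && reduced f else true.

Lemma survivesP c f : survives c f ->
  all (linked c) f \/ exists g1 e g2,
    [/\ f = g1 ++ e :: g2, all (linked c) g1, ~~ linked c e & e != inv_letter c].
Proof.
rewrite /survives; elim: f => [|e f IHf] /=; first by left.
case: ifP => [nce ie|/negbFE ce /IHf [cf|[g1 [e' [g2 [-> cg nce ie]]]]]].
- by right; exists [::], e, f.
- by left; rewrite ce.
- by right; exists (e :: g1), e', g2; rewrite /= ce.
Qed.

Lemma survivesPn c f : ~~ survives c f ->
  exists g1 g2, f = g1 ++ inv_letter c :: g2 /\ all (linked c) g1.
Proof.
rewrite /survives negbK; elim: f => [|e f IHf] /=.
  by rewrite eq_sym (negPf (inv_letter_neq c)).
case: ifP => [_ /= /eqP ->|/negbFE ce /IHf [g1 [g2 [-> cg]]]].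
  by exists [::], f.
by exists (e :: g1), g2; rewrite /= ce.
Qed.

Lemma survives_catl c f1 f2 : survives c (f1 ++ f2) -> survives c f1.
Proof.
rewrite /survives filter_cat; case: [seq _ <- f1 | _] => //= _.
by rewrite eq_sym inv_letter_neq.
Qed.

(** The second occurrence of [c] shields the first one from everything that
    follows. *)
Lemma survives_cat_self c f f' : survives c f -> survives c (f ++ c :: f').
Proof.
rewrite /survives filter_cat; case: [seq _ <- f | _] => //= _.
by rewrite /linked adj_irrefl /= eq_sym inv_letter_neq.
Qed.

Lemma reduced_catr w1 w2 : reduced (w1 ++ w2) -> reduced w2.
Proof. by elim: w1 => //= c w1 IHw /andP[_]. Qed.

Lemma reduced_catl w1 w2 : reduced (w1 ++ w2) -> reduced w1.
Proof.
by elim: w1 => //= c w1 IHw /andP[/survives_catl -> /IHw].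
Qed.

(** If deleting [d] allowed [c] to cancel with an inverse in [f2], then [d]
    would separate them; but [d] commutes with all of [f2], in particular with
    this inverse. *)
Lemma reduced_delete f1 d f2 :
  all (linked d) f2 -> reduced (f1 ++ d :: f2) -> reduced (f1 ++ f2).
Proof.
move=> df2; elim: f1 => [|c f1 IHf] /=; first by case/andP.
case/andP=> sc /IHf ->; rewrite andbT; move: sc.
rewrite /survives !filter_cat; case: [seq _ <- f1 | _] => //=.
case: ifP => [ncd _|//]; apply/eqP => hf2.
have: inv_letter c \in [seq e <- f2 | ~~ linked c e].
  case: [seq _ <- f2 | _] hf2 => [|e s /= ->]; last exact: mem_head.
  by move/esym/eqP; rewrite (negPf (inv_letter_neq c)).
rewrite mem_filter => /andP[_ /(allP df2)].
by rewrite /linked adj_sym => dc; rewrite /linked dc in ncd.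
Qed.

(** Let [e] be the first letter of [f] not adjacent to [c].  By induction the
    remainder of the product from [e] on lies in the half-space of [e], and so
    outside that of [c^-1]; the letters in between preserve the half-spaces of
    both [c] and [c^-1].  The condition on [z] concerns the letters for which no
    such [e] exists: these can be moved next to [z]. *)
Lemma reduced_halfspace z c f : reduced (c :: f) ->
  (forall w1 d u, c :: f = w1 ++ d :: u -> all (linked d) u ->
     ~~ halfspace (inv_letter d) z) ->
  halfspace c (raag_of (c :: f) * z).
Proof.
have [n] := ubnP (size f); elim: n c f => // n IHn c f.
rewrite ltnS => szf /= /andP[sc rf] hz.
rewrite raag_of_cons -mulgA halfspace_letterM.
case: (survivesP sc) => [cf|[g1 [e [g2 [fE cg1 nce ie]]]]].
  by rewrite halfspace_spanned_l //; [exact: hz [::] _ _ _ cf | exact: spanned_linked].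
rewrite fE raag_of_catM -mulgA halfspace_spanned_l; last exact: spanned_linked.
apply: (@halfspace_disjoint _ e); rewrite // 1?adj_sym //.
apply: IHn.
- by move: szf; rewrite fE size_cat /= addnS; apply: leq_trans; rewrite ltnS leq_addl.
- by rewrite fE in rf; exact: reduced_catr rf.
- move=> w1 d u eE; apply: (hz (c :: g1 ++ w1)).
  by rewrite fE /= -catA -eE.
Qed.

(** A letter of [f] that commutes with everything after it, [b] included, can
    be absorbed into [z].  If there is none, then each letter that can be moved
    next to [z] is not adjacent to [b], and disjointness provides the condition
    of [reduced_halfspace]. *)
Lemma halfspace_nested a f b z : reduced (a :: rcons f b) -> ~~ linked a b ->
  halfspace b z -> halfspace a (raag_of (a :: f) * z).
Proof.
have [n] := ubnP (size f); elim: n f z => // n IHn f z.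
rewrite ltnS => szf rf nab bz.
have [[f1 [d [f2 [fE df2]]]]|min] := pselect (exists f1 d f2,
    f = f1 ++ d :: f2 /\ all (linked d) (rcons f2 b)).
  have /andP[db df2'] : linked d b && all (linked d) f2 by rewrite -all_rcons.
  have -> : raag_of (a :: f) * z = raag_of (a :: f1 ++ f2) * (letter_val d * z).
    rewrite fE !raag_of_cons !raag_of_catM raag_of_cons (commute_linked df2').
    by rewrite !mulgA.
  apply: IHn => //.
  - move: szf; rewrite fE !size_cat /= addnS; exact: leq_trans.
  - rewrite rcons_cat; apply: (@reduced_delete (a :: f1) d) => //.
    by move: rf; rewrite fE rcons_cat.
  - by rewrite halfspace_spanned_l //; apply: spanned_letter; rewrite adj_sym.
apply: reduced_halfspace; first by apply: (@reduced_catl _ [:: b]); rewrite cats1.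
move=> w1 d u afE du.
have ndb : ~~ linked d b.
  case: w1 afE => [|a' f1] [ea fE]; first by rewrite -ea.
  by apply/negP=> db; apply: min; exists f1, d, u; rewrite all_rcons db.
apply: halfspace_disjoint bz; first by rewrite adj_sym.
have: survives d (rcons u b).
  move: rf; rewrite -rcons_cons afE rcons_cat => /reduced_catr.
  by rewrite rcons_cons /= => /andP[].
rewrite /survives -cats1 filter_cat /= ndb.
rewrite (@eq_in_filter _ _ pred0) ?filter_pred0 // => e eu.
by rewrite /= (allP du).
Qed.

(** A reduced word lies in the half-space of [l] only if [l] can be moved to
    its front. *)
Lemma not_halfspace l k : reduced k ->
  (forall k1 k2, k = k1 ++ l :: k2 -> ~~ all (linked l) k1) ->
  ~~ halfspace l (raag_of k).
Proof.
elim: k => [|d k IHk]; first by rewrite halfspace1.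
move=> rk hk; have [ld|nld] := boolP (linked l d).
  rewrite raag_of_cons halfspace_spanned_l; last exact: spanned_letter.
  apply: IHk => [|k1 k2 kE]; first by case/andP: rk.
  by have := hk (d :: k1) k2; rewrite kE /= ld; apply.
apply: (@halfspace_disjoint _ d); first by rewrite adj_sym.
  by apply/eqP => dl; have := hk [::] k; rewrite dl => /(_ erefl).
rewrite -[raag_of _]mulg1; apply: reduced_halfspace => // *; exact: halfspace1.
Qed.

Lemma reduced_or_shorter w : reduced w \/
  exists2 w', raag_of w' = raag_of w & size w' < size w.
Proof.
elim: w => [|c f [rf|[f' fE szf]]]; first by left.
  have [sc|/survivesPn[g1 [g2 [fE cg]]]] := boolP (survives c f).
    by left; rewrite /= sc.
  right; exists (g1 ++ g2).
    rewrite raag_of_cons fE !raag_of_catM raag_of_cons.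
    by rewrite mulgA (commute_linked cg) -mulgA (mulgA (letter_val c)) letter_valK mul1g.
  by rewrite fE /= !size_cat /= addnS ltnS leqW.
by right; exists (c :: f') => //; rewrite !raag_of_cons fE.
Qed.

End Reduced.

(** * Commuting conjugates of generators and star steps *)

Section Commuting.
Variable G : sgraph.
Implicit Types (x y z : raag G) (w f k : word G) (c d : letter G) (u v : G).

Lemma raag_length_le w : raag_length (raag_of w) <= size w.
Proof.
rewrite /raag_length; case: ex_minnP => m _; apply.
by apply/asboolP; exists w.
Qed.

Lemma shortest_word_exists (g : raag G) : exists w, shortest_word g w.
Proof.
have := erefl (raag_length g); rewrite {1}/raag_length.
by case: ex_minnP => m /asboolP[w wg sw] _ mg; exists w; split; rewrite // sw.
Qed.

Lemma short_reduced w : size w <= raag_length (raag_of w) -> reduced w.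
Proof.
case: (reduced_or_shorter w) => // -[w' w'E szw' szw].
by have := raag_length_le w'; rewrite w'E leqNgt (leq_trans szw').
Qed.

Lemma commute_star v x : spanned (star v) x -> commute (raag_gen v) x.
Proof.
case=> w + <-; elim: w => [_|c w IHw /= /andP[cv /IHw cw]]; first exact: commute1.
rewrite raag_of_cons; apply: commuteM => //.
have [cvE|ncv] := eqVneq c.1 v.
  case: c cvE {cv} => _ [] /= ->; first exact: commute_refl.
  by rewrite (letter_val_inv (v, true)); apply/commuteV/commute_refl.
by apply: (@commute_letter _ (v, true)); move: cv; rewrite /star /= (negPf ncv).
Qed.

Lemma conj_star v x y : spanned (star v) x -> raag_gen v ^ (x * y) = raag_gen v ^ y.
Proof.
by move/commute_star => cx; rewrite conjgM [_ ^ x]conjgE cx mulKg.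
Qed.

Lemma starE c v : star v c.1 = (c.1 == v) || adj v c.1.
Proof. by []. Qed.

(** Shorten [k] as long as possible by cancellation, by removing on the left
    letters of the star of [v] and on the right letters of the star of [u].  If
    a last letter [c] remains, then [k^-1 v k] lies in the half-space of
    [c^-1], because [k^-1] is reduced and none of its letters cancels against
    [v k].  Commutation with [u] would put an element in the half-spaces of
    both [u] and [c^-1], which are disjoint as [c] is not in the star of [u]. *)
Lemma commuting_conj_word v u k :
  commute (raag_gen v ^ raag_of k) (raag_gen u) ->
  exists p q, [/\ spanned (star v) p, spanned (star u) q & raag_of k = p * q].
Proof.
have [n] := ubnP (size k); elim: n k => // n IHn k; rewrite ltnS => szk com.
case: (reduced_or_shorter k) => [rk|[k' k'E szk']]; last first.
  by rewrite -k'E; apply: IHn; rewrite ?k'E //; exact: leq_trans szk' szk.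
case: (reduced_or_shorter (inv_word k)) => [rik|[k' k'E szk']]; last first.
  have {}k'E : raag_of (inv_word k') = raag_of k.
    by rewrite raag_of_invM k'E raag_of_invM invgK.
  rewrite -k'E; apply: IHn; rewrite ?k'E //.
  move: szk'; rewrite /inv_word !size_rev !size_map => szk'.
  exact: leq_trans szk' szk.
have [[k1 [c [k2 [kE ck1 vc]]]]|nofirst] := pselect (exists k1 c k2,
    [/\ k = k1 ++ c :: k2, all (linked c) k1 & star v c.1]).
  have {}kE' : raag_of k = letter_val c * raag_of (k1 ++ k2).
    by rewrite kE !raag_of_catM raag_of_cons !mulgA (commute_linked ck1).
  have vp : spanned (star v) (letter_val c) by exact: spanned_letter.
  case: (IHn (k1 ++ k2)) => [||p [q [Pp Qq pq]]].
  - by move: szk; rewrite kE !size_cat /= addnS.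
  - by move: com; rewrite kE' conj_star.
  - by exists (letter_val c * p), q; rewrite kE' pq mulgA; split=> //; exact: spannedM.
case/lastP: k szk com rk rik nofirst => [|k c] szk com rk rik nofirst.
  by exists 1, 1; rewrite mulg1; split=> //; exact: spanned1.
have [uc|nuc] := boolP (star u c.1).
  have uq : spanned (star u) (letter_val c) by exact: spanned_letter.
  case: (IHn k) => [||p [q [Pp Qq pq]]].
  - by rewrite size_rcons in szk.
  - apply: (conjg_inj (letter_val c)); rewrite [LHS]conjMg [RHS]conjMg.
    rewrite -conjgM -raag_of_rcons.
    have -> : raag_gen u ^ letter_val c = raag_gen u; last exact: com.
    by rewrite -[letter_val c]mulg1 conj_star // conjg1.
  - exists p, (q * letter_val c); rewrite raag_of_rcons pq mulgA.
    by split=> //; exact: spannedM.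
exfalso; set x := raag_gen v ^ _ in com.
have xc : halfspace (inv_letter c) x.
  have ikE : inv_word (rcons k c) = inv_letter c :: inv_word k.
    by rewrite -cats1 inv_word_cat.
  rewrite /x conjgE -raag_of_invM ikE; apply: reduced_halfspace; rewrite -ikE //.
  move=> w1 d w2 ikE' dw2.
  have vd : ~~ star v d.1.
    apply/negP => vd; apply: nofirst; exists (inv_word w2), (inv_letter d), (inv_word w1).
    split=> //.
      by rewrite -[LHS]inv_wordK ikE' -cat1s !inv_word_cat -catA.
    by rewrite /inv_word all_rev all_map; apply: sub_all dw2 => -[].
  move: vd; rewrite starE negb_or => /andP[dv nvd].
  apply: (@halfspace_disjoint _ (v, true)) => //.
    by apply/eqP => /(congr1 fst) /= vE; rewrite -vE eqxx in dv.
  rewrite -letter_val_pos halfspace_letterM; apply: not_halfspace => // k1 k2 kE.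
  by apply/negP=> vk1; apply: nofirst; exists k1, (inv_letter (v, true)), k2;
    rewrite kE /= /star /= eqxx.
move: nuc; rewrite starE negb_or => /andP[cu nuc].
have : halfspace (u, true) (raag_gen u * x).
  rewrite -letter_val_pos halfspace_letterM.
  apply: halfspace_disjoint xc; rewrite /= 1?adj_sym //.
  by apply/eqP => /(congr1 fst) /= cE; rewrite cE eqxx in cu.
apply/negP; rewrite -com; apply: (@halfspace_disjoint _ (inv_letter c)).
- by rewrite /= adj_sym.
- by apply/eqP => /(congr1 fst) /= cE; rewrite cE eqxx in cu.
- rewrite halfspace_spanned_r //; apply: (@spanned_letter _ _ (u, true)).
  by rewrite /= eq_sym.
Qed.

Lemma commuting_conj v u x y :
  commute (raag_gen v ^ x) (raag_gen u ^ y) ->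
  exists p q, [/\ spanned (star v) p, spanned (star u) q & x * y^-1 = p * q].
Proof.
move=> com; rewrite -[x * _]raag_of_repr; apply: commuting_conj_word.
rewrite raag_of_repr conjgM; apply: (conjg_inj y).
by rewrite [LHS]conjMg [RHS]conjMg conjgKV.
Qed.

(** The vertex [v ^ x] of the extension graph corresponds to the coset
    x^-1 <St v>; this is why inverses appear when paths of the extension graph
    are turned into star paths. *)
Fixpoint star_path n x y : Prop :=
  if n is m.+1 then exists z, (exists v, spanned (star v) (x^-1 * z)) /\ star_path m z y
  else x = y.

Lemma star_path_cat m n x y z :
  star_path m x y -> star_path n y z -> star_path (m + n) x z.
Proof.
elim: m x => [x /= ->//|m IHm] x [t [xt ty]] yz.
by exists t; split=> //; exact: IHm.
Qed.

Lemma star_path_word x w : star_path (size w) x (x * raag_of w).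
Proof.
elim: w x => [|c w IHw] x /=; first by rewrite raag_of_nil mulg1.
exists (x * letter_val c); split; last by rewrite raag_of_cons mulgA; exact: IHw.
by exists c.1; rewrite mulKg; apply: spanned_letter; rewrite /star eqxx.
Qed.

(** The two factors of [commuting_conj] are the two steps. *)
Lemma star_path_commute v u x y :
  commute (raag_gen v ^ x) (raag_gen u ^ y) -> star_path 2 x^-1 y^-1.
Proof.
case/commuting_conj => p [q [Pp Qq pq]].
exists (x^-1 * p); split; first by exists v; rewrite mulKg.
exists y^-1; split=> //; exists u.
by rewrite invgM invgK -mulgA pq mulKg.
Qed.

Lemma ext_adj_star_path (X : ext_vertex G) p v u x y :
  path (@ext_adj G) X p -> val X = raag_gen v ^ x ->
  val (last X p) = raag_gen u ^ y -> star_path (size p).+1.*2 x^-1 y^-1.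
Proof.
elim: p X v x => [|Y p IHp] X v x /=.
  by move=> _ -> vx; apply: (@star_path_commute v u); rewrite vx; exact: commute_refl.
case/andP=> /andP[_ /eqP XY] pY Xv lE.
have /asboolP[t [z Yt]] := valP Y.
apply: (@star_path_cat 2 _ _ _ _ _ (IHp _ _ _ pY Yt lE)).
by apply: (@star_path_commute v t); rewrite -Xv -Yt.
Qed.

End Commuting.

(** * Sets of vertices that are not contained in a join *)

Section Joins.
Variable G : sgraph.
Implicit Types (A B S T : {set G}) (u v : G).

Lemma in_join_sub S T : S \subset T -> in_join T -> in_join S.
Proof. by move=> ST [H jH TH]; exists H => //; exact: subset_trans TH. Qed.

Lemma in_joinU A B : [disjoint A & B] -> A != set0 -> B != set0 ->
  {in A & B, forall a b, adj a b} -> in_join (A :|: B).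
Proof.
move=> dAB A0 B0 AB.
pose e := [rel x y : G | (x \in A) && (y \in B) || (y \in A) && (x \in B)].
have e_sym : symmetric e by move=> x y /=; rewrite orbC.
have eP x y : e x y -> [/\ x \in A :|: B, y \in A :|: B & adj x y].
  case/orP => /andP[xA yB]; rewrite !inE xA yB ?orbT; split=> //; first exact: AB.
  by rewrite adj_sym; exact: AB.
exists (Subgraph e_sym eP) => //; exists A, B; split=> // a b aA bB.
by rewrite /= aA bB.
Qed.

(** The complement graph of the subgraph induced on [S], with loops. *)
Definition nonadj S : rel G := fun x y => [&& x \in S, y \in S & ~~ adj x y].

(** A connected component of the complement graph is joined to the rest. *)
Lemma not_join_connect S : ~ in_join S -> {in S &, forall a b, connect (nonadj S) a b}.
Proof.
move=> nj a b aS bS; apply: contrapT => /negP nab; apply: nj.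
pose A := [set x in S | connect (nonadj S) a x].
have -> : S = A :|: (S :\: A).
  by apply/setP => x; rewrite !inE; case: (x \in S) => //=; case: (connect _ _ _).
apply: in_joinU.
- rewrite -setI_eq0; apply/eqP/setP => x; rewrite !inE.
  by case: (x \in S); case: (connect _ _ _).
- by apply/set0Pn; exists a; rewrite !inE aS connect0.
- by apply/set0Pn; exists b; rewrite !inE bS andbT (negPf nab).
move=> x y; rewrite !inE => /andP[xS ax] /andP[nay yS].
rewrite yS /= in nay; apply: contraNT nay => nxy.
by apply: connect_trans ax (connect1 _); rewrite /nonadj xS yS.
Qed.

(** In a connected graph with two vertices links are nonempty, so that every
    star is the join of its centre and its link. *)
Lemma not_join_star S v : connected_graph G -> 1 < #|G| -> ~ in_join S ->
  exists2 a, a \in S & ~~ star v a.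
Proof.
move=> conn card nj; have [u vu] : exists u, adj v u.
  have /card_gt1P[x [y [_ _ xy]]] := card.
  have [t tv] : exists t, t != v.
    by case: (eqVneq x v) => [<-|]; [exists y; rewrite eq_sym | exists x].
  case/connectP: (conn v t) => [[|u p]] /=; first by move=> _ tE; rewrite tE eqxx in tv.
  by case/andP=> vu _ _; exists u.
apply: contrapT => nex; apply: nj.
apply: (@in_join_sub _ ([set v] :|: [set x | adj v x])).
  apply/subsetP => x xS; rewrite !inE; apply: contrapT => /negP nx.
  by apply: nex; exists x.
apply: in_joinU.
- rewrite -setI_eq0; apply/eqP/setP => x; rewrite !inE.
  by case: eqP => // ->; rewrite adj_irrefl.
- by apply/set0Pn; exists v; rewrite inE.
- by apply/set0Pn; exists u; rewrite inE.
- by move=> a b; rewrite !inE => /eqP->.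
Qed.

End Joins.

(** * Graph distance *)

Section Distance.
Variables (T : eqType) (e : rel T).

Lemma gdist_walk x y n : gdist e x y = Some n -> has_walk e x y n.
Proof.
rewrite /gdist; case: pselect => // h [<-].
by case: ex_minnP => m /asboolP.
Qed.

Lemma gdist_le x y n : has_walk e x y n -> exists2 m, gdist e x y = Some m & m <= n.
Proof.
move=> w; rewrite /gdist; case: pselect => [h|[]]; last by exists n; apply/asboolP.
by exists (ex_minn h) => //; case: ex_minnP => m _; apply; apply/asboolP.
Qed.

End Distance.

(** * Shortest words and cyclic reduction *)

Section Support.
Variable G : sgraph.
Implicit Types (w : word G) (g : raag G) (v : G).

Lemma raag_cong_kill v w1 w2 : raag_cong w1 w2 ->
  raag_cong [seq c <- w1 | c.1 != v] [seq c <- w2 | c.1 != v].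
Proof.
elim=> {w1 w2} [w|w1 w2 _|w1 w2 w3 _ h1 _ h2|w1 w2 w1' w2' _ h1 _ h2|c|a b ab] /=.
- exact: RC_refl.
- exact: RC_sym.
- exact: RC_trans h2.
- by rewrite !filter_cat; exact: RC_cat.
- by case: (c.1 != v); [exact: RC_cancel | exact: RC_refl].
- by case: (a != v); case: (b != v); by [exact: RC_refl | exact: RC_comm].
Qed.

(** The endomorphism that kills [v] fixes [g] if some word for [g] avoids [v];
    it would then strictly shorten any word for [g] that contains [v]. *)
Lemma support_sub_shortest g w v :
  shortest_word g w -> v \in raag_support g -> v \in map fst w.
Proof.
case=> wg sw; rewrite inE => /asboolP[w' [w'g sw'] vw'].
apply: contraT => vw.
have fw : [seq c <- w | c.1 != v] = w.
  by apply/all_filterP/allP => c cw; apply: contraNneq vw => <-; exact: map_f.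
have : raag_of [seq c <- w' | c.1 != v] = g.
  rewrite -wg -fw; apply/raag_ofP/raag_cong_kill/raag_ofP; by rewrite w'g wg.
move=> fg; have := raag_length_le [seq c <- w' | c.1 != v].
rewrite fg -sw' size_filter -[size w'](count_predC (fun c => c.1 != v)).
rewrite -[leqRHS]addn0 leq_add2l leqn0 eqn0Ngt -has_count.
move/hasPn => h; case: vw' => /h /=; by rewrite eqxx.
Qed.

Lemma letter_support g w c : shortest_word g w -> c \in w -> c.1 \in raag_support g.
Proof.
move=> sw cw; rewrite inE; apply/asboolP; exists w => //.
by case: c cw => u [] cw; [left | right].
Qed.

(** Every rotation of [w] represents a conjugate of [g] and has the length of
    [g], so it is reduced; in [w ++ w] the next occurrence of a letter shields
    it from all that lies more than one period away. *)
Lemma reduced_square g w :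
  cyclically_reduced g -> shortest_word g w -> reduced (w ++ w).
Proof.
move=> cr [wg sw].
have rot w1 w2 : w = w1 ++ w2 -> reduced (w2 ++ w1).
  move=> wE; apply: short_reduced.
  have -> : raag_of (w2 ++ w1) = g ^ raag_of w1.
    by rewrite -wg wE conjgE !raag_of_catM !mulgA mulVg mul1g.
  by apply: leq_trans (cr _); rewrite -sw wE !size_cat addnC.
suff h w1 w2 : w = w1 ++ w2 -> reduced (w2 ++ w) by exact: (h [::]).
elim: w2 w1 => [|c w2 IHw] w1 wE.
  by have := rot [::] w erefl; rewrite cats0.
rewrite /= (IHw (rcons w1 c)); last by rewrite cat_rcons.
rewrite andbT wE catA; apply: survives_cat_self.
by have /= /andP[] := rot _ _ wE.
Qed.

End Support.

(** * Supports in a join give bounded orbits *)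

Section JoinElliptic.
Variable G : sgraph.
Implicit Types (A B : {set G}) (x y : raag G).

(** Letters of [B] centralize <A>, so conjugation by them does nothing. *)
Lemma conj_join A B x y : {in A & B, forall a b, adj a b} ->
  spanned (mem (A :|: B)) y -> spanned (mem A) x -> spanned (mem A) (x ^ y).
Proof.
move=> AB [w + <-]; elim: w x => [|c w IHw] x /=.
  by rewrite raag_of_nil conjg1.
case/andP=> cAB /IHw h Ax; rewrite raag_of_cons conjgM; apply: h.
have [cA|cA] := boolP (c.1 \in A).
  have cS : spanned (mem A) (letter_val c) by exact: spanned_letter.
  by rewrite conjgE; apply: spannedM; [exact: spannedV | exact: spannedM].
have cB : c.1 \in B by move: cAB; rewrite /= inE (negPf cA).
suff cx : commute (letter_val c) x by rewrite conjgE -cx mulKg.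
by apply: commute_spanned Ax => a aA; rewrite adj_sym; exact: AB.
Qed.

Lemma gen_is_ext_vertex (v : G) : is_ext_vertex (raag_gen v).
Proof. by apply/asboolP; exists v, 1; rewrite conjg1. Qed.

Definition ext_gen (v : G) : ext_vertex G := Sub (raag_gen v) (gen_is_ext_vertex v).

Lemma commute_walk (X Y : ext_vertex G) :
  commute (val X) (val Y) -> exists2 n, has_walk (@ext_adj G) X Y n & n <= 1.
Proof.
move=> XY; have [->|neq] := eqVneq X Y; first by exists 0 => //; exists [::].
exists 1%N => //; exists [:: Y]; split=> //=; rewrite andbT /ext_adj neq.
exact/eqP.
Qed.

Lemma join_elliptic (g : raag G) : g <> 1 -> in_join (raag_support g) -> elliptic g.
Proof.
move=> g1 [H [A [B [AB _ A0 B0 hAB]]] sH]; split=> //.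
have {hAB} adjAB : {in A & B, forall a b, adj a b}.
  by move=> a b aA bB; case: (sub_adjP (hAB a b aA bB)).
have [a aA] := set0Pn _ A0; have [b bB] := set0Pn _ B0.
have gS : spanned (mem (A :|: B)) g.
  have [w sw] := shortest_word_exists g; case: (sw) => wg _.
  exists w => //; apply/allP => c /(letter_support sw) /(subsetP sH).
  by rewrite AB.
exists (ext_gen a).
have orb Y : cyclic_orbit g (ext_gen a) Y -> commute (val Y) (raag_gen b).
  case=> n YE; have [h [hS ->]] : exists h, spanned (mem (A :|: B)) h /\
     Y = ext_act (ext_gen a) h.
    case: YE => ->; eexists; split; try reflexivity; first exact: spannedX.
    exact/spannedV/spannedX.
  have Ah : spanned (mem A) (raag_gen a ^ h).
    by apply: conj_join adjAB hS _; apply: (@spanned_letter _ _ (a, true)).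
  apply/commute_sym; apply: (@commute_spanned _ (mem A) (b, true)) Ah => v vA.
  by rewrite adj_sym; exact: adjAB.
exists 2 => X Y /orb Xb /orb Yb.
have [m [p [pX lp szp]] m1] := commute_walk (Y := ext_gen b) Xb.
have [n [q [qb lq szq]] n1] := commute_walk (X := ext_gen b) (commute_sym Yb).
have [|k kd kn] := @gdist_le _ (@ext_adj G) X Y (m + n).
  by exists (p ++ q); rewrite cat_path last_cat size_cat lp szp szq pX.
by exists k => //; apply: leq_trans kn (leq_add m1 n1).
Qed.

End JoinElliptic.

(** * Half-spaces along the axis of a cyclically reduced element *)

Section Axis.
Variables (G : sgraph) (w : word G).
Implicit Types (x y : raag G) (a b u v : G).

Let g := raag_of w.

(** The half-space entered when the axis [w w w ...] first traverses an edge
    labelled [a]. *)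
Definition axis_halfspace a y : bool :=
  let i := find (fun c => c.1 == a) w in
  halfspace (nth (a, true) w i) ((raag_of (take i w))^-1 * y).

Lemma axis_halfspaceP a : a \in map fst w -> exists pre c post,
  [/\ w = pre ++ c :: post, c.1 = a, spanned (predC1 a) (raag_of pre)
    & forall y, axis_halfspace a y = halfspace c ((raag_of pre)^-1 * y)].
Proof.
move=> aw; have hw : has (fun c : letter G => c.1 == a) w.
  by case/mapP: aw => c cw ->; apply/hasP; exists c.
pose i := find (fun c : letter G => c.1 == a) w.
have iw : i < size w by rewrite -has_find.
exists (take i w), (nth (a, true) w i), (drop i.+1 w); split=> //.
- by rewrite -drop_nth // cat_take_drop.
- exact/eqP/(nth_find (a, true) hw).
- exists (take i w) => //; apply/(all_nthP (a, true)) => j.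
  rewrite size_take iw => ji; rewrite nth_take //=.
  by have := before_find (a, true) ji => /= ->.
Qed.

Lemma axis_halfspace1 a : a \in map fst w -> ~~ axis_halfspace a 1.
Proof.
case/axis_halfspaceP => pre [c [post [_ ca Ppre ->]]].
by rewrite mulg1; apply: halfspace_spanned; rewrite ca; exact: spannedV.
Qed.

Lemma axis_halfspace_pow1 a : a \in map fst w -> reduced w -> axis_halfspace a g.
Proof.
case/axis_halfspaceP => pre [c [post [wE _ _ ->]]] rw.
rewrite /g wE raag_of_catM mulKg -[raag_of _]mulg1.
apply: reduced_halfspace; first by rewrite wE in rw; exact: reduced_catr rw.
by move=> *; exact: halfspace1.
Qed.

Lemma axis_halfspaceMr a y s : a \in map fst w -> spanned (predC1 a) s ->
  axis_halfspace a (y * s) = axis_halfspace a y.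
Proof.
case/axis_halfspaceP => pre [c [post [_ ca _ KE]]] Ps.
by rewrite !KE mulgA halfspace_spanned_r // ca.
Qed.

Hypothesis ww_reduced : reduced (w ++ w).

(** The letter at the first [b] of the second period comes after the letter at
    the first [a] of the first one, inside the reduced word [w ++ w]. *)
Lemma axis_halfspace_next a b y :
  a \in map fst w -> b \in map fst w -> ~~ adj a b ->
  axis_halfspace b (g^-1 * y) -> axis_halfspace a y.
Proof.
case/axis_halfspaceP => prea [c [posta [waE ca _ ->]]].
case/axis_halfspaceP => preb [d [postb [wbE db _ ->]]] nab.
set z := _ * (g^-1 * y) => dz.
have -> : (raag_of prea)^-1 * y = raag_of (c :: posta ++ preb) * z.
  have gE : raag_of prea * raag_of (c :: posta ++ preb) = g * raag_of preb.
    by rewrite -cat_cons [raag_of (_ ++ _)]raag_of_catM mulgA /g [in RHS]waE raag_of_catM.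
  apply: (mulgI (raag_of prea)); rewrite mulVKg (mulgA (raag_of prea)) gE /z.
  by rewrite -(mulgA g) !mulVKg.
apply: (halfspace_nested (b := d)) dz; last by rewrite /linked ca db.
move: ww_reduced; rewrite {1}waE wbE -catA => /reduced_catr.
by rewrite cat_cons -cat_rcons -cats1 !catA -cat_cons => /reduced_catl; rewrite cats1.
Qed.

(** [axis_halfspace a (shift n y)] says that [y] lies in the translate by the
    [n]-th power of [raag_of w] of the half-space of [a]. *)
Definition shift n y := (g ^+ n)^-1 * y.

Lemma shiftD m n y : shift (m + n) y = shift m (shift n y).
Proof. by rewrite /shift addnC expgnDr invgM mulgA. Qed.

Let S := [set v | v \in map fst w].

Lemma axis_halfspace_path a p n y :
  path (nonadj S) a p -> a \in S -> size p <= n ->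
  axis_halfspace (last a p) (shift n y) -> axis_halfspace a y.
Proof.
have self m b z : b \in S -> axis_halfspace b (shift m z) -> axis_halfspace b z.
  rewrite inE => bS; elim: m z => [|m IHm] z; first by rewrite /shift expg0 invg1 mul1g.
  rewrite -addn1 shiftD => /IHm; rewrite /shift expg1.
  by apply: axis_halfspace_next; rewrite ?adj_irrefl.
elim: p a n y => [|b p IHp] a n y /=; first by move=> _ aS _; exact: self.
case/andP=> /and3P[aS bS nab] pb _; case: n => // n szp.
rewrite -addn1 shiftD => /(IHp _ _ _ pb bS szp); rewrite /shift expg1.
by rewrite !inE in aS bS; apply: axis_halfspace_next.
Qed.

Hypothesis S_connected : {in S &, forall a b, connect (nonadj S) a b}.

Lemma axis_halfspace_far a b y : a \in S -> b \in S ->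
  axis_halfspace b (shift #|G| y) -> axis_halfspace a y.
Proof.
move=> aS bS; case/connectP: (S_connected aS bS) => p0 pp0 ->.
case/shortenP: pp0 => p pp uniqp _; apply: axis_halfspace_path => //.
by have := max_card (mem (a :: p)); rewrite (card_uniqP uniqp) /=; exact: ltnW.
Qed.

Hypothesis S_star : forall v, exists2 a, a \in S & ~~ star v a.

(** In each step, pass from [a] to a vertex [u] outside the star in question,
    where nothing changes, and back to [a]; each passage costs [#|G|]. *)
Lemma axis_halfspace_star_path a m n x y : a \in S -> star_path n x y ->
  axis_halfspace a (shift (m + n * (#|G| + #|G|)) y) -> axis_halfspace a (shift m x).
Proof.
move=> aS; elim: n m x => [|n IHn] m x /=; first by move->; rewrite addn0.
case=> z [[v vs] /IHn IH]; rewrite mulSn addnA => /IH.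
have [u uS nvu] := S_star v.
rewrite (addnC m) -addnA shiftD => /(axis_halfspace_far uS aS).
have -> : z = x * (x^-1 * z) by rewrite mulVKg.
rewrite [shift (_ + _) _]/shift mulgA axis_halfspaceMr; last 2 first.
- by rewrite inE in uS.
- by apply: sub_spanned vs => t vt /=; apply: contraTneq vt => ->.
rewrite -/(shift (_ + _) x) shiftD; exact: axis_halfspace_far.
Qed.

Lemma star_path_pow n N : star_path n 1 (g ^+ N) ->
  (exists a, a \in S) -> N <= n * (#|G| + #|G|).
Proof.
move=> sp [a aS]; rewrite leqNgt; apply/negP => ltN.
have aw : a \in map fst w by rewrite inE in aS.
have /negP := axis_halfspace1 aw; apply.
have := @axis_halfspace_star_path a 0 n 1 (g ^+ N) aS sp.
rewrite add0n [shift 0 1]/shift expg0 mulg1 invg1; apply.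
apply: (@axis_halfspace_path a [::] (N.-1 - n * (#|G| + #|G|))) => //=.
rewrite -shiftD subnK; last by rewrite -ltnS prednK //; exact: leq_ltn_trans ltN.
have -> : g ^+ N = g ^+ N.-1 * g.
  by rewrite -expgSr prednK //; exact: leq_ltn_trans ltN.
rewrite /shift mulKg; apply: axis_halfspace_pow1 => //.
exact: reduced_catl ww_reduced.
Qed.

End Axis.

Theorem theorem35 (G : sgraph) (hconn : connected_graph G)
    (hcard : (1 < #|G|)%N) (g : raag G) (hg1 : g <> 1%g)
    (hred : cyclically_reduced g) :
  elliptic g <-> in_join (raag_support g).
Proof.
split; last exact: join_elliptic.
case=> _ [X [M bounded]].
have [w sw] := shortest_word_exists g; have [wg szw] := sw.
apply: (@in_join_sub _ _ [set v | v \in map fst w]).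
  by apply/subsetP => v /(support_sub_shortest sw); rewrite inE.
apply: contrapT => nj.
have /asboolP[v [h Xh]] := valP X.
have [l hl] : exists l, raag_of l = h by exists (repr h); rewrite raag_of_repr.
(* A bound for the star steps from 1 to h^-1, on to g^N h^-1, then to g^N. *)
pose R := (size (inv_word l) + (M.+1.*2 + size l))%N.
pose N := (R * (#|G| + #|G|)).+1.
have X0 : X = ext_act X (g ^+ 0) by apply: val_inj; rewrite /= expg0 conjg1.
have [n /gdist_walk [p [pX lp szp]] nM] := bounded X (ext_act X (g ^- N))
  (ex_intro _ 0 (or_introl X0)) (ex_intro _ N (or_intror erefl)).
have lE : val (last X p) = raag_gen v ^ (h * g ^- N) by rewrite lp /= Xh conjgM.
have path1 := star_path_word 1 (inv_word l).
have path2 := ext_adj_star_path pX Xh lE.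
have path3 := star_path_word (g ^+ N * h^-1) l.
rewrite mul1g raag_of_invM hl in path1; rewrite invgM invgK in path2.
rewrite hl mulgVK in path3.
have path := star_path_cat path1 (star_path_cat path2 path3).
have S_star := not_join_star _ hconn hcard nj.
rewrite -wg in path.
have [a aS _] := S_star v.
have := star_path_pow (reduced_square hred sw) (not_join_connect nj) S_star path
  (ex_intro _ a aS).
apply/negP; rewrite -ltnNge /N ltnS leq_mul2r; apply/orP; right.
by rewrite /R !leq_add2l leq_add2r szp leq_double.
Qed.
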